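(* Let $1\le p,q\le\infty$ and let $m,n\ge2$ be integers. (i) If $p^{-1}+q^{-1}\le1$, then $C_{\mathrm{NJ}}(\ell_p^m\widehat\otimes_{\varepsilon}\ell_q^n)=2$. (ii) For every $p,q$, $C_{\mathrm{NJ}}(\ell_p^m\widehat\otimes_{\pi}\ell_q^n)=2$.
   Context: Scalars are $\mathbb K\in\{\mathbb R,\mathbb C\}$; $\ell_p^m$ is $\mathbb K^m$ with the $\ell_p$ norm, and $1/\infty=0$. For a Banach space $X$, the von Neumann--Jordan constant is $$C_{\mathrm{NJ}}(X)=\sup\left\{\frac{\|x+y\|^{2}+\|x-y\|^{2}}{2(\|x\|^{2}+\|y\|^{2})}: x,y\in X,\ (x,y)\neq(0,0)\right\}.$$ For Banach spaces $X,Y$ over $\mathbb K$, and $w=\sum_{j=1}^r x_j\otimes y_j$ in the algebraic tensor product $X\otimes Y$, the injective norm is $\|w\|_\varepsilon=\sup\{|\sum_{j} x^*(x_j)y^*(y_j)|: x^*\in B_{X^*},\,y^*\in B_{Y^*}\}$ and the projective norm is $\|w\|_\pi=\inf\{\sum_{j}\|x_j\|\|y_j\|: w=\sum_{j} x_j\otimes y_j\}$. The completions of $X\otimes Y$ for these norms are denoted $X\widehat\otimes_\varepsilon Y$ and $X\widehat\otimes_\pi Y$. *)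

(* Defs.v *)
From HB Require Import structures.
From mathcomp Require Import all_boot all_order all_algebra complex.
From mathcomp Require Import all_classical all_reals all_analysis.
Set Implicit Arguments.
Unset Strict Implicit.
Unset Printing Implicit Defensive.
Import Order.TTheory GRing.Theory Num.Theory.
Import numFieldNormedType.Exports.
Local Open Scope classical_set_scope.
Local Open Scope ring_scope.

Inductive scalar_kind := RealScalars | ComplexScalars.

Definition scalars (R : realType) (k : scalar_kind) : numFieldType :=
  match k with
  | RealScalars => R
  | ComplexScalars => R[i]
  end.

(* In MathComp-Analysis the norm of a normedModType K takes its values in K,
   hence in R[i] when the scalars are complex; there it is a real element of
   R[i], so reading it back in R through its real part loses nothing. *)
Definition real_of (R : realType) (k : scalar_kind) : scalars R k -> R :=
  match k with
  | RealScalars => fun a => a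
  | ComplexScalars => fun a => complex.Re a
  end.

Definition sabs (R : realType) (k : scalar_kind) (a : scalars R k) : R :=
  real_of `|a|.

Definition rnorm (R : realType) (k : scalar_kind)
  (E : normedModType (scalars R k)) (x : E) : R := real_of `|x|.

(* The value at p < 1 (including -oo) is irrelevant: only 1 <= p <= +oo is
   ever used. *)
Definition lp_norm (R : realType) (k : scalar_kind) (p : \bar R) (m : nat)
    (x : 'rV[scalars R k]_m) : R :=
  match p with
  | r%:E => (\sum_(i < m) sabs (x 0 i) `^ r) `^ r^-1
  | +oo%E => \big[Num.max/0]_(i < m) sabs (x 0 i)
  | -oo%E => 0
  end.

(* Von Neumann-Jordan constant, as a supremum in the extended reals. *)
Definition CNJ (R : realType) (k : scalar_kind)
    (E : normedModType (scalars R k)) : \bar R :=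
  ereal_sup [set ((rnorm (z.1 + z.2) ^+ 2 + rnorm (z.1 - z.2) ^+ 2) /
                  (2 * (rnorm z.1 ^+ 2 + rnorm z.2 ^+ 2)))%:E
            | z in [set z : E * E | z <> (0, 0)]].

(* The algebraic tensor product K^m (x) K^n is the space of m x n matrices,
   the elementary tensor x (x) y being the matrix with entries x_i * y_j. *)
Definition tens (K : numFieldType) (m n : nat) (x : 'rV[K]_m) (y : 'rV[K]_n) :
  'M[K]_(m, n) := x^T *m y.

Definition dual_ball (R : realType) (k : scalar_kind) (m : nat)
    (N : 'rV[scalars R k]_m -> R) :
    set {linear 'rV[scalars R k]_m -> (scalars R k)^o} :=
  [set f | forall x, sabs (f x) <= N x].

(* The scalar \sum_j f (x_j) * g (y_j) does not depend on the representation
   of w, so the supremum may range over all the representations as well. *)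
Definition injective_norm (R : realType) (k : scalar_kind) (m n : nat)
    (NX : 'rV[scalars R k]_m -> R) (NY : 'rV[scalars R k]_n -> R)
    (w : 'M[scalars R k]_(m, n)) : R :=
  sup [set c : R | exists (r : nat) (x : 'I_r -> 'rV[scalars R k]_m)
      (y : 'I_r -> 'rV[scalars R k]_n)
      (f : {linear 'rV[scalars R k]_m -> (scalars R k)^o})
      (g : {linear 'rV[scalars R k]_n -> (scalars R k)^o}),
    [/\ w = \sum_(j < r) tens (x j) (y j),
        dual_ball NX f, dual_ball NY g &
        c = sabs (\sum_(j < r) (f (x j) : scalars R k) * g (y j))]].

Definition projective_norm (R : realType) (k : scalar_kind) (m n : nat)
    (NX : 'rV[scalars R k]_m -> R) (NY : 'rV[scalars R k]_n -> R)
    (w : 'M[scalars R k]_(m, n)) : R :=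
  inf [set c : R | exists (r : nat) (x : 'I_r -> 'rV[scalars R k]_m)
      (y : 'I_r -> 'rV[scalars R k]_n),
    w = \sum_(j < r) tens (x j) (y j) /\
    c = \sum_(j < r) NX (x j) * NY (y j)].

(* E, together with the embedding i, is a completion of V for the norm N: E is
   a Banach space and i is a linear isometry with dense range. *)
Definition is_completion (R : realType) (k : scalar_kind)
    (V : lmodType (scalars R k)) (N : V -> R)
    (E : completeNormedModType (scalars R k)) (i : {linear V -> E}) : Prop :=
  (forall v, rnorm (i v) = N v) /\ dense (range i).

(* Main.v *)
Require Import Defs.
From HB Require Import structures.
From mathcomp Require Import all_boot all_order all_algebra complex.
From mathcomp Require Import all_classical all_reals all_analysis.
From mathcomp Require Import ring lra.
Import Order.TTheory GRing.Theory Num.Theory.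
Import numFieldNormedType.Exports.
Local Open Scope ring_scope.
Local Open Scope classical_set_scope.
Set Implicit Arguments.
Unset Strict Implicit.
Unset Printing Implicit Defensive.

(** The constant never exceeds 2, because each of |u + v| and |u - v| is at most
    |u| + |v| and (|u| + |v|)^2 <= 2(|u|^2 + |v|^2). It equals 2 as soon as some
    x, y and c > 0 satisfy |x|, |y| <= c and |x + y|, |x - y| >= 2c
    ([CNJ_eq2]), so in each case the proof exhibits such a pair among matrices
    supported on a 2 x 2 block.

    Injective norm, 1/p + 1/q <= 1: take x, y = e1 (x) e1 +- e2 (x) e2 and c = 1.
    Then x +- y are doubled elementary tensors, of norm 2, while |x|, |y| <= 1
    follows from |f1 g1| + |f2 g2| <= 1 for f and g in the dual balls. These
    functionals have coordinates in the unit balls of l_p' and l_q' with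
    1/p' + 1/q' >= 1, so this is Hoelder's inequality.

    Projective norm, 1/p + 1/q >= 1: take x = e1 (x) e1, y = e2 (x) e2 and c = 1.
    The lower bound on x +- y comes from duality: the form w11 +- w22 takes the
    value 2 there, and by the same inequality it is bounded by 1 on products of
    unit vectors.

    Projective norm, 1/p + 1/q <= 1: the form w11 + w22 now has norm
    2^(1 - 1/p - 1/q), too large for the pair above if 1/p + 1/q < 1. Take
    x = (e1 + e2) (x) (e1 + e2) and y = (e1 - e2) (x) (e1 - e2), both of norm at
    most c = 2^(1/p + 1/q). Up to a factor 2, x + y and x - y are the identity
    and the flip of the 2 x 2 block, on which w11 + w22, resp. w12 + w21, take
    the value 4 = 2^(1 - 1/p - 1/q) * 2c.

    All these two-coordinate Hoelder inequalities are treated uniformly in p and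
    q, infinity included, by writing a pair (a, b) of l_p norm M as
    a <= M alpha^(1/p), b <= M beta^(1/p) with alpha + beta <= 1: they then become
    inequalities between powers of sub-probability vectors, which follow from
    the weighted arithmetic-geometric mean inequality. *)

(** * Absolute value and norm over both kinds of scalars *)

Section Scalars.
Variables (R : realType) (k : scalar_kind).
Implicit Types (s t : R) (a b z : scalars R k).

Definition of_real : R -> scalars R k :=
  match k with RealScalars => fun t => t | ComplexScalars => fun t => t%:C%C end.

Lemma of_realD s t : of_real (s + t) = of_real s + of_real t.
Proof. by rewrite /of_real; case: k => //=; exact: rmorphD. Qed.

Lemma of_realM s t : of_real (s * t) = of_real s * of_real t.
Proof. by rewrite /of_real; case: k => //=; exact: rmorphM. Qed.

Lemma of_real1 : of_real 1 = 1.
Proof. by rewrite /of_real; case: k. Qed.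

Lemma of_real0 : of_real 0 = 0.
Proof. by rewrite /of_real; case: k. Qed.

Lemma ler_of_real s t : (of_real s <= of_real t) = (s <= t).
Proof. by rewrite /of_real; case: k => //=; rewrite lecR. Qed.

Lemma of_realK t : real_of (of_real t) = t.
Proof. by rewrite /of_real /real_of; case: k. Qed.

Lemma real_ofK (z : scalars R k) : 0 <= z -> of_real (real_of z) = z.
Proof.
move: z; rewrite /of_real /real_of; case: k => //= -[x y].
by rewrite lecE /= => /andP[/eqP -> _].
Qed.

Lemma of_real_inj : injective of_real.
Proof. exact: can_inj of_realK. Qed.

Lemma of_real_rnorm (E : normedModType (scalars R k)) (x : E) :
  of_real (rnorm x) = `|x|.
Proof. by rewrite real_ofK. Qed.

Lemma of_real_sabs a : of_real (sabs a) = `|a|.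
Proof. by rewrite real_ofK. Qed.

Lemma sabs_ge0 a : 0 <= sabs a.
Proof. by rewrite -ler_of_real of_real0 of_real_sabs. Qed.

Lemma sabs0 : sabs (0 : scalars R k) = 0.
Proof. by rewrite /sabs normr0 -of_real0 of_realK. Qed.

Lemma sabs1 : sabs (1 : scalars R k) = 1.
Proof. by rewrite /sabs normr1 -of_real1 of_realK. Qed.

Lemma sabsN a : sabs (- a) = sabs a.
Proof. by rewrite /sabs normrN. Qed.

Lemma sabsM a b : sabs (a * b) = sabs a * sabs b.
Proof. by apply: of_real_inj; rewrite of_realM !of_real_sabs normrM. Qed.

Lemma sabsD a b : sabs (a + b) <= sabs a + sabs b.
Proof. by rewrite -ler_of_real of_realD !of_real_sabs ler_normD. Qed.

Lemma sabs_of_real t : 0 <= t -> sabs (of_real t) = t.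
Proof. by move=> t0; rewrite /sabs ger0_norm ?of_realK // -of_real0 ler_of_real. Qed.

Lemma sabs_sum (I : Type) (r : seq I) (F : I -> scalars R k) :
  sabs (\sum_(j <- r) F j) <= \sum_(j <- r) sabs (F j).
Proof.
elim/big_rec2: _ => [|j s a _ le_as]; first by rewrite sabs0.
by rewrite (le_trans (sabsD _ _)) // lerD2l.
Qed.

Lemma rnormD (E : normedModType (scalars R k)) (x y : E) :
  rnorm (x + y) <= rnorm x + rnorm y.
Proof. by rewrite -ler_of_real of_realD !of_real_rnorm ler_normD. Qed.

Lemma rnormN (E : normedModType (scalars R k)) (x : E) : rnorm (- x) = rnorm x.
Proof. by rewrite /rnorm normrN. Qed.

Lemma rnorm_ge0 (E : normedModType (scalars R k)) (x : E) : 0 <= rnorm x.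
Proof. by rewrite -ler_of_real of_real0 of_real_rnorm. Qed.

Lemma rnorm0 (E : normedModType (scalars R k)) : rnorm (0 : E) = 0.
Proof. by rewrite /rnorm normr0 -of_real0 of_realK. Qed.

(** The unimodular phase that turns a coordinate of a functional into its
    modulus. *)
Lemma phase_ex z : exists2 c, sabs c = 1 & c * z = of_real (sabs z).
Proof.
have [->|z0] := eqVneq z 0.
  by exists 1; rewrite ?sabs1 // sabs0 of_real0 mulr0.
exists (`|z| / z); last by rewrite mulfVK // of_real_sabs.
apply: of_real_inj.
by rewrite of_real_sabs of_real1 normrM normfV normr_id divff ?normr_eq0.
Qed.

End Scalars.
Arguments of_real {R} k.

(** * The von Neumann-Jordan constant of a space containing a copy of l_1^2 *)

(** After scaling by c, the hypotheses force |x| = |y| = 1 and |x +- y| = 2, as for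
    the unit vectors of the real l_1^2, where the defining quotient is 2, its
    largest possible value. *)
Lemma CNJ_eq2 (R : realType) (k : scalar_kind) (E : normedModType (scalars R k))
    (x y : E) (c : R) : 0 < c -> rnorm x <= c -> rnorm y <= c ->
  2 * c <= rnorm (x + y) -> 2 * c <= rnorm (x - y) -> CNJ E = 2%:E.
Proof.
move=> c0 xc yc xyc xyc'; apply/eqP; rewrite eq_le; apply/andP; split.
  apply: ge_ereal_sup => _ [[u v] _ <-] /=; rewrite lee_fin.
  have u0 := rnorm_ge0 u; have v0 := rnorm_ge0 v.
  have uv := rnormD u v; have := rnormD u (- v); rewrite rnormN => uv'.
  have := rnorm_ge0 (u + v); have := rnorm_ge0 (u - v).
  have [->|d0] := eqVneq (2 * (rnorm u ^+ 2 + rnorm v ^+ 2)) 0.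
    by rewrite invr0 mulr0.
  have d_gt0 : 0 < 2 * (rnorm u ^+ 2 + rnorm v ^+ 2).
    by rewrite lt_def d0 mulr_ge0 // addr_ge0 // sqr_ge0.
  move=> h h'; rewrite ler_pdivrMr //.
  have sq s : 0 <= s -> s <= rnorm u + rnorm v -> s ^+ 2 <= (rnorm u + rnorm v) ^+ 2.
    by move=> s0 s_le; rewrite ler_sqr ?nnegrE ?addr_ge0.
  have := sq _ h uv'; have := sq _ h' uv.
  have := sqr_ge0 (rnorm u - rnorm v); nra.
apply: (le_trans _ (ereal_sup_ubound _)); last first.
  exists (x, y); last by reflexivity.
  by move=> [x0 y0]; move: xyc; rewrite x0 y0 addr0 rnorm0; lra.
rewrite lee_fin /=.
have x0 := rnorm_ge0 x; have y0 := rnorm_ge0 y.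
have x_gt0 : 0 < rnorm x by have := rnormD x y; lra.
rewrite ler_pdivlMr; nra.
Qed.

(** * Hoelder inequalities on two coordinates *)

Section TwoPoint.
Variable R : realType.
Implicit Types (a b c d r s t x y z u : R) (p q : \bar R).

Lemma powR_le_tangent u r : 0 <= u -> 0 <= r -> u `^ r <= expR (r * (u - 1)).
Proof.
move=> u0 r0; have := expR_ge1Dx (u - 1); rewrite addrC subrK => le_u.
rewrite mulrC expRM; apply: ge0_ler_powR; rewrite ?nnegrE ?expR_ge0 //.
Qed.

(** With M the weighted mean, the product of the tangent bounds
    (x/M)^r <= exp(r(x/M - 1)) over the three factors has exponent
    M/M - (r + s + t) = 0. *)
Lemma weighted_AMGM3 x y z r s t : 0 <= x -> 0 <= y -> 0 <= z ->
  0 <= r -> 0 <= s -> 0 <= t -> r + s + t = 1 ->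
  x `^ r * y `^ s * z `^ t <= r * x + s * y + t * z.
Proof.
move=> x0 y0 z0 r0 s0 t0 rst1; set M := r * x + s * y + t * z.
have rx0 := mulr_ge0 r0 x0; have sy0 := mulr_ge0 s0 y0; have tz0 := mulr_ge0 t0 z0.
have M0 : 0 <= M by rewrite !addr_ge0.
have [M_eq0|M_neq0] := eqVneq M 0.
  rewrite M_eq0; move: M_eq0; rewrite /M => M_eq0.
  (* one of the weights is positive, and its base then vanishes *)
  have [r_eq0|rN0] := eqVneq r 0; last first.
    have -> : x = 0 by apply: (mulfI rN0); rewrite mulr0; lra.
    by rewrite powR0 // !mul0r.
  have [s_eq0|sN0] := eqVneq s 0; last first.
    have -> : y = 0 by apply: (mulfI sN0); rewrite mulr0; lra.
    by rewrite powR0 // mulr0 mul0r.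
  have tN0 : t != 0 by apply/eqP; lra.
  have -> : z = 0 by apply: (mulfI tN0); rewrite mulr0; lra.
  by rewrite powR0 // mulr0.
have M_gt0 : 0 < M by rewrite lt_def M_neq0.
have scale w e : 0 <= w -> w `^ e = M `^ e * (w / M) `^ e.
  by move=> w0; rewrite -powRM ?divr_ge0 // mulrC divfK.
rewrite (scale x) // (scale y) // (scale z) //.
have -> : forall A B C D E F : R, A * B * (C * D) * (E * F) = A * C * E * (B * D * F).
  by move=> *; ring.
rewrite -!powRD ?rst1 ?powRr1 ?M_neq0 ?implybT // -[leRHS]mulr1 ler_wpM2l //.
have tan w e : 0 <= w -> 0 <= e -> (w / M) `^ e <= expR (e * (w / M - 1)).
  by move=> w0 e0; apply: powR_le_tangent; rewrite ?divr_ge0.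
apply: (@le_trans _ _ (expR (r * (x / M - 1)) * expR (s * (y / M - 1)) *
                       expR (t * (z / M - 1)))).
  by rewrite !ler_pM ?mulr_ge0 ?powR_ge0 ?tan.
rewrite -!expRD.
have -> : r * (x / M - 1) + s * (y / M - 1) + t * (z / M - 1) = M / M - (r + s + t).
  by rewrite /M; field; exact: M_neq0.
by rewrite rst1 divff // subrr expR0.
Qed.

Lemma powR_unit_anti u r s : 0 <= u <= 1 -> 0 <= s <= r -> u `^ r <= u `^ s.
Proof.
move=> /andP[u0 u1] /andP[s0 sr].
have [->|uN0] := eqVneq u 0; last by rewrite ger_powR // u1 lt_def uN0 u0.
have [r0|rN0] := eqVneq r 0; last by rewrite powR0 // powR_ge0.
by have -> : s = r by lra.
Qed.

Definition subprob a b := [/\ 0 <= a, 0 <= b & a + b <= 1].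

(** Since a, b <= 1, lowering the exponent r to 1 - s only increases the left-hand
    side; for exponents of sum 1 the weighted mean inequality, summed over the
    two coordinates, gives (1 - s)(a + b) + s(c + d) <= 1. *)
Lemma two_point_holder_ge1 r s a b c d : subprob a b -> subprob c d ->
  0 <= r <= 1 -> 0 <= s <= 1 -> 1 <= r + s ->
  a `^ r * c `^ s + b `^ r * d `^ s <= 1.
Proof.
move=> [a0 b0 ab1] [c0 d0 cd1] /andP[r0 r1] /andP[s0 s1] rs1.
have young x y : 0 <= x <= 1 -> 0 <= y -> x `^ r * y `^ s <= (1 - s) * x + s * y.
  move=> /andP[x0 x1] y0.
  apply: (@le_trans _ _ (x `^ (1 - s) * y `^ s)).
    by rewrite ler_wpM2r ?powR_ge0 // powR_unit_anti //; lra.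
  have h := @weighted_AMGM3 x y 0 (1 - s) s 0 x0 y0 (lexx 0) _ s0 (lexx 0) _.
  rewrite (le_trans _ (le_trans (h _ _) _)) ?powRr0 ?mulr1 ?mul0r ?addr0 ?subr_ge0 //.
  by rewrite subrK.
have := young a c; have := young b d => h1 h2.
have {}h1 := h1 ltac:(lra) d0; have {}h2 := h2 ltac:(lra) c0.
by nra.
Qed.

(** The missing exponent t = 1 - r - s is given to a third vector, the uniform one
    (1/2, 1/2): summing the weighted means over the two coordinates gives at most
    r + s + t = 1, and the factor 2^t undoes (1/2)^t. *)
Lemma two_point_holder_le1 r s a b c d : subprob a b -> subprob c d ->
  0 <= r -> 0 <= s -> r + s <= 1 ->
  a `^ r * c `^ s + b `^ r * d `^ s <= 2 `^ (1 - r - s).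
Proof.
move=> [a0 b0 ab1] [c0 d0 cd1] r0 s0 rs1; set t := 1 - r - s.
have t0 : 0 <= t by rewrite /t; lra.
have young x y : 0 <= x -> 0 <= y ->
    x `^ r * y `^ s <= 2 `^ t * (r * x + s * y + t * 2^-1).
  move=> x0 y0.
  have h0 : 0 <= 2^-1 :> R by rewrite invr_ge0.
  have h := weighted_AMGM3 x0 y0 h0 r0 s0 t0 _.
  rewrite (le_trans _ (ler_wpM2l (powR_ge0 _ _) (h _))) //; last by rewrite /t; ring.
  by rewrite mulrCA -powRM ?invr_ge0 ?ler0n // divff ?pnatr_eq0 // powR1 mulr1.
apply: (le_trans (lerD (young a c a0 c0) (young b d b0 d0))).
rewrite -mulrDr -[leRHS]mulr1 ler_wpM2l ?powR_ge0 //.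
by rewrite /t; nra.
Qed.

Definition pair_norm p a b : R :=
  match p with
  | r%:E => (a `^ r + b `^ r) `^ r^-1
  | +oo%E => Num.max a b
  | -oo%E => 0
  end.

Lemma pair_norm_ge0 p a b : 0 <= a -> 0 <= pair_norm p a b.
Proof.
by move=> a0; case: p => [r| |] //=; rewrite ?powR_ge0 // le_max a0.
Qed.

(** The exponent 1/p, equal to 0 for p = +oo. *)
Definition rexp p : R := fine (p^-1)%E.

Lemma rexpP p : (1 <= p)%E -> (p^-1)%E = (rexp p)%:E /\ 0 <= rexp p <= 1.
Proof.
rewrite /rexp; case: p => [r| |] //= h.
  rewrite lee_fin in h; have r0 : r != 0 by apply/eqP; lra.
  rewrite inver (negbTE r0) /= invr_ge0 invf_le1; last by lra.
  by rewrite h andbT; split=> //; lra.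
by rewrite invey /= lexx ler01.
Qed.

(** For finite p, the sub-probability vector is (a^p, b^p) divided by its sum; for
    p = +oo the exponent is 0 and the zero vector works, since 0^0 = 1. *)
Lemma pair_norm_profile p a b : (1 <= p)%E -> 0 <= a -> 0 <= b ->
  exists al be, [/\ subprob al be, a <= pair_norm p a b * al `^ rexp p &
                    b <= pair_norm p a b * be `^ rexp p].
Proof.
case: p => [r| |] //= h a0 b0; rewrite /rexp; last first.
  exists 0, 0; rewrite invey /= powRr0 !mulr1 !le_max !lexx orbT; split=> [|//|//].
  by split; rewrite ?addr0 ?ler01.
rewrite lee_fin in h; have r0 : r != 0 by apply/eqP; lra.
rewrite inver (negbTE r0) /=; set S := a `^ r + b `^ r.
have ar0 := powR_ge0 a r; have br0 := powR_ge0 b r.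
have S0 : 0 <= S by rewrite addr_ge0.
exists (a `^ r / S), (b `^ r / S).
have [SE|SN0] := eqVneq S 0.
  rewrite SE; move: SE; rewrite /S => SE.
  have /powR_eq0_eq0 -> : a `^ r = 0 by lra.
  have /powR_eq0_eq0 -> : b `^ r = 0 by lra.
  by rewrite invr0 !mulr0 !mulr_ge0 ?powR_ge0 //; split=> //; split=> //; rewrite addr0.
rewrite -!powRM ?divr_ge0 // ![S * _]mulrC !divfK // -!powRrM mulfV // !powRr1 //.
by split=> //; split; rewrite ?divr_ge0 // -mulrDl divff.
Qed.

(** Transfers an inequality between powers of sub-probability vectors to l_p and
    l_q norms, by homogeneity. *)
Lemma pair_holder p q a b c d C : (1 <= p)%E -> (1 <= q)%E ->
  0 <= a -> 0 <= b -> 0 <= c -> 0 <= d ->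
  (forall x y z t, subprob x y -> subprob z t ->
    x `^ rexp p * z `^ rexp q + y `^ rexp p * t `^ rexp q <= C) ->
  a * c + b * d <= C * (pair_norm p a b * pair_norm q c d).
Proof.
move=> hp hq a0 b0 c0 d0 hC.
have [x [y [xy ax ay]]] := pair_norm_profile hp a0 b0.
have [z [t [zt cz dt]]] := pair_norm_profile hq c0 d0.
have M0 : 0 <= pair_norm p a b := pair_norm_ge0 _ _ a0.
have N0 : 0 <= pair_norm q c d := pair_norm_ge0 _ _ c0.
apply: (le_trans (lerD (ler_pM a0 c0 ax cz) (ler_pM b0 d0 ay dt))).
rewrite mulrACA [X in _ + X]mulrACA -mulrDr mulrC ler_wpM2r ?mulr_ge0 //.
exact: hC.
Qed.

(** The converse of Hoelder's inequality: a pair of dual norm at most 1 lies in the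
    unit ball of l_p', where 1/p' = 1 - 1/p. For 1 < p < +oo, testing on
    (a^(p' - 1), b^(p' - 1)) gives S <= S^(1/p) for S = a^p' + b^p', hence S <= 1. *)
Lemma dual_pair_profile p a b : (1 <= p)%E -> 0 <= a -> 0 <= b ->
  (forall s t, 0 <= s -> 0 <= t -> s * a + t * b <= pair_norm p s t) ->
  exists al be, [/\ subprob al be, a <= al `^ (1 - rexp p) &
                    b <= be `^ (1 - rexp p)].
Proof.
case: p => [r| |] //= h a0 b0 hab; rewrite /rexp; last first.
  exists a, b; rewrite invey /= subr0 !powRr1 //; split=> //; split=> //.
  by have := hab 1 1 ler01 ler01; rewrite !mul1r maxxx.
rewrite lee_fin in h; have r0 : r != 0 by apply/eqP; lra.
rewrite inver (negbTE r0) /=.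
(* for p = 1 the exponent 1 - 1/p is 0, and the unit vectors bound a and b by 1 *)
have [r1|rN1] := eqVneq r 1.
  exists 0, 0; rewrite r1 invr1 subrr !powRr0; split.
  - by split=> //; lra.
  - have := hab 1 0 ler01 (lexx 0).
    by rewrite r1 invr1 mul1r mul0r addr0 !powRr1 ?addr0.
  - have := hab 0 1 (lexx 0) ler01.
    by rewrite r1 invr1 mul1r mul0r add0r !powRr1 ?add0r.
have r_gt1 : 1 < r by rewrite lt_def rN1.
have rB1 : r - 1 != 0 by rewrite subr_eq0.
pose r' := r / (r - 1).
have r'0 : 0 < r' by rewrite divr_gt0 ?subr_gt0 //; lra.
have r'E : (r' - 1) * r = r' by rewrite /r'; field.
have r'V : r' * (1 - r^-1) = 1 by rewrite /r'; field; apply/andP.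
exists (a `^ r'), (b `^ r'); rewrite -!powRrM r'V !powRr1 //; split=> //.
split; rewrite ?powR_ge0 //.
have := hab _ _ (powR_ge0 a (r' - 1)) (powR_ge0 b (r' - 1)).
rewrite -!powRrM r'E ![_ `^ (r' - 1) * _]mulrC !mulr_powRB1 //.
set S := _ + _ => SS; rewrite leNgt; apply/negP => S1.
have rV1 : r^-1 < 1 by rewrite invf_lt1; lra.
have : S `^ r^-1 < S.
  rewrite -[ltRHS]powRr1; last by lra.
  rewrite /powR gt_eqF; last by lra.
  by rewrite ltr_expR ltr_pM2r // ln_gt0.
by rewrite ltNge SS.
Qed.

End TwoPoint.

(** * The l_p norm on vectors supported on two coordinates *)

Section LpRows.
Variables (R : realType) (k : scalar_kind).
Implicit Types (p q : \bar R).
Local Notation K := (scalars R k).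

Lemma lp_norm_ge0 p m (x : 'rV[K]_m) : 0 <= lp_norm p x.
Proof.
by case: p => [r| |] //=; [exact: powR_ge0 | exact: bigmax_ge_id].
Qed.

Lemma pair_norm_le_lp_norm p m (x : 'rV[K]_m) (i j : 'I_m) : (1 <= p)%E -> i != j ->
  pair_norm p (sabs (x 0 i)) (sabs (x 0 j)) <= lp_norm p x.
Proof.
case: p => [r| |] //= h ij; last by rewrite ge_max !le_bigmax.
have r0 : 0 <= r by rewrite lee_fin in h; lra.
apply: ge0_ler_powR; rewrite ?invr_ge0 ?nnegrE ?addr_ge0 ?powR_ge0 //.
  by apply: sumr_ge0 => l _; exact: powR_ge0.
rewrite (bigD1 i) //= (bigD1 j) 1?eq_sym //= addrA lerDl.
by apply: sumr_ge0 => l _; exact: powR_ge0.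
Qed.

Lemma lp_norm_pair p m (i j : 'I_m) (a b : K) : (1 <= p)%E -> i != j ->
  lp_norm p (a *: 'e_i + b *: 'e_j) = pair_norm p (sabs a) (sabs b).
Proof.
move=> hp ij; set x := a *: _ + _.
have xi : x 0 i = a by rewrite !mxE !eqxx (negbTE ij) mulr1 mulr0 addr0.
have xj : x 0 j = b.
  by rewrite !mxE !eqxx [j == i]eq_sym (negbTE ij) mulr1 mulr0 add0r.
have xl l : l != i -> l != j -> x 0 l = 0.
  by move=> li lj; rewrite !mxE (negbTE li) (negbTE lj) !mulr0 addr0.
have := pair_norm_le_lp_norm x hp ij; rewrite xi xj => le_x.
apply/eqP; rewrite eq_le le_x andbT {le_x}.
case: p hp => [r| |] //= hp; last first.
  apply/bigmax_leP; split; first by rewrite le_max sabs_ge0.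
  move=> l _; have [->|li] := eqVneq l i; first by rewrite xi le_max lexx.
  have [->|lj] := eqVneq l j; first by rewrite xj le_max lexx orbT.
  by rewrite xl // sabs0 le_max sabs_ge0.
have r0 : r != 0 by rewrite lee_fin in hp; apply/eqP; lra.
rewrite (bigD1 i) //= (bigD1 j) 1?eq_sym //= big1 ?addr0 ?xi ?xj // => l /andP[li lj].
by rewrite xl // sabs0 powR0.
Qed.

Lemma pair_norm10 p : (1 <= p)%E -> pair_norm p 1 0 = 1.
Proof.
case: p => [r| |] //= h; last by rewrite /Num.max ltNge ler01.
have r0 : r != 0 by rewrite lee_fin in h; apply/eqP; lra.
by rewrite powR1 powR0 // addr0 powR1.
Qed.

Lemma pair_norm11 p : (1 <= p)%E -> pair_norm p 1 1 = 2 `^ rexp p.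
Proof.
rewrite /rexp; case: p => [r| |] h //; last by rewrite /= maxxx ?invey powRr0.
rewrite /=.
have r0 : r != 0 by rewrite lee_fin in h; apply/eqP; lra.
by rewrite inver (negbTE r0) powR1.
Qed.

Lemma lp_norm_delta p m (i j : 'I_m) : (1 <= p)%E -> i != j ->
  lp_norm p ('e_i : 'rV[K]_m) = 1.
Proof.
move=> hp ij; have := lp_norm_pair 1 0 hp ij.
by rewrite scale1r scale0r addr0 sabs1 sabs0 pair_norm10.
Qed.

Lemma tensE m n (x : 'rV[K]_m) (y : 'rV[K]_n) i j : tens x y i j = x 0 i * y 0 j.
Proof. by rewrite !mxE big_ord1 !mxE. Qed.

Lemma sum_of_tens m n (w : 'M[K]_(m, n)) : w = \sum_(i < m) tens 'e_i (row i w).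
Proof.
apply/matrixP => i j; rewrite summxE (bigD1 i) //= tensE !mxE !eqxx mul1r.
rewrite big1 ?addr0 // => l li.
by rewrite tensE !mxE eqxx [i == l]eq_sym (negbTE li) mul0r.
Qed.

End LpRows.

(** * Bounds on the projective norm *)

Section Projective.
Variables (R : realType) (k : scalar_kind) (m n : nat).
Local Notation K := (scalars R k).
Variables (NX : 'rV[K]_m -> R) (NY : 'rV[K]_n -> R).
Hypotheses (NX0 : forall x, 0 <= NX x) (NY0 : forall y, 0 <= NY y).

Lemma projective_norm_tens_le x y : projective_norm NX NY (tens x y) <= NX x * NY y.
Proof.
apply: ge_inf; last first.
  by exists 1%N, (fun=> x), (fun=> y); rewrite !big_ord1.
exists 0 => _ [r [xs [ys [_ ->]]]].
by apply: sumr_ge0 => j _; rewrite mulr_ge0.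
Qed.

(** Duality: a form bounded by C on elementary tensors is bounded by C times the
    cost of every representation of w. *)
Lemma projective_norm_ge (phi : {linear 'M[K]_(m, n) -> K^o}) (C : R) w : 0 < C ->
  (forall x y, sabs (phi (tens x y)) <= C * (NX x * NY y)) ->
  sabs (phi w) <= C * projective_norm NX NY w.
Proof.
move=> C0 hphi; rewrite mulrC -ler_pdivrMr //; apply: lb_le_inf.
  exists (\sum_(i < m) NX 'e_i * NY (row i w)).
  by exists m, (fun i => 'e_i), (fun i => row i w); split=> //; exact: sum_of_tens.
move=> _ [r [xs [ys [-> ->]]]]; rewrite ler_pdivrMr // mulrC mulr_sumr linear_sum.
by apply: (le_trans (sabs_sum _ _)); apply: ler_sum => j _; exact: hphi.
Qed.

End Projective.

(** * Bounds on the injective norm *)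

Section Injective.
Variables (R : realType) (k : scalar_kind) (m n : nat).
Local Notation K := (scalars R k).
Variables (NX : 'rV[K]_m -> R) (NY : 'rV[K]_n -> R).

(** The form f (x) g on matrices is written w |-> f((w G)^T), where G is the column
    of the values of g on the unit vectors: linearity in w is then visible. *)
Lemma form_tens (f : {linear 'rV[K]_m -> K^o}) (g : {linear 'rV[K]_n -> K^o})
    x y :
  (f ((tens x y *m \col_j g 'e_j)^T) : K) = f x * g y.
Proof.
have -> : tens x y *m \col_j g 'e_j = (g y : K) *: x^T.
  have gE : (g y : K) = \sum_l y 0 l * (g 'e_l : K).
    by rewrite {1}[y]row_sum_delta linear_sum; apply: eq_bigr => l _; rewrite linearZ.
  apply/matrixP => i j; rewrite mxE [RHS]mxE gE mulr_suml; apply: eq_bigr => l _.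
  by rewrite tensE !mxE (ord1 j) [x 0 i * _]mulrC mulrAC.
by rewrite linearZ /= trmxK linearZ /= mulrC.
Qed.

(** The pairing with f (x) g depends on the tensor only, not on its representation. *)
Lemma injective_sum (f : {linear 'rV[K]_m -> K^o}) (g : {linear 'rV[K]_n -> K^o})
    r (x : 'I_r -> 'rV[K]_m) (y : 'I_r -> 'rV[K]_n) :
  \sum_(j < r) (f (x j) : K) * g (y j) =
  f (((\sum_(j < r) tens (x j) (y j)) *m \col_j g 'e_j)^T).
Proof.
rewrite mulmx_suml !linear_sum; apply: eq_bigr => j _.
by rewrite -form_tens.
Qed.

(** The upper bound NX x * NY y is what makes the supremum a genuine one: the
    supremum of an unbounded set of reals would be 0 by convention. *)
Lemma injective_norm_tens_ge (f : {linear 'rV[K]_m -> K^o})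
    (g : {linear 'rV[K]_n -> K^o}) x y :
  (forall z, 0 <= NX z) -> dual_ball NX f -> dual_ball NY g ->
  sabs (f x) * sabs (g y) <= injective_norm NX NY (tens x y).
Proof.
move=> NX0 hf hg; apply: ub_le_sup.
  exists (NX x * NY y) => _ [r [xs [ys [f' [g' [wE hf' hg' ->]]]]]].
  rewrite injective_sum -wE form_tens sabsM.
  by rewrite ler_pM ?sabs_ge0 ?hf' ?hg'.
exists 1%N, (fun=> x), (fun=> y), f, g; split=> //; first by rewrite big_ord1.
by rewrite big_ord1 sabsM.
Qed.

Lemma injective_norm_le w (C : R) : 0 <= C ->
  (forall f g, dual_ball NX f -> dual_ball NY g ->
     sabs (f ((w *m \col_j g 'e_j)^T)) <= C) ->
  injective_norm NX NY w <= C.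
Proof.
move=> C0 hC; rewrite /injective_norm; set A := [set _ | _].
have [->|A0] := eqVneq A set0; first by rewrite sup0.
apply: ge_sup; first exact/set0P.
by move=> _ [r [xs [ys [f [g [wE hf hg ->]]]]]]; rewrite injective_sum -wE; exact: hC.
Qed.

End Injective.

(** * Forms on the tensor products of l_p^m and l_q^n *)

Section Forms.
Variables (R : realType) (k : scalar_kind).
Implicit Types (p q : \bar R).
Local Notation K := (scalars R k).
Local Notation lp p := (@lp_norm R k p _).

Lemma sabs_nat n : sabs (n%:R : K) = n%:R.
Proof.
suff <- : of_real k (n%:R : R) = n%:R by rewrite sabs_of_real.
elim: n => [|n IHn]; first exact: of_real0.
by rewrite -addn1 !natrD of_realD IHn of_real1.
Qed.

(** The target is K^o so that the map can carry a linear structure. *)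
Definition entry m n (i : 'I_m) (j : 'I_n) (w : 'M[K]_(m, n)) : K^o := w i j.

Lemma entry_is_linear m n (i : 'I_m) (j : 'I_n) : linear (entry i j).
Proof. by move=> a u v; rewrite /entry !mxE. Qed.

HB.instance Definition _ m n (i : 'I_m) (j : 'I_n) :=
  GRing.isLinear.Build K 'M[K]_(m, n) K^o *:%R (entry i j) (entry_is_linear i j).

Lemma entry_dual_ball p m (i j : 'I_m) : (1 <= p)%E -> i != j ->
  dual_ball (lp p) (entry 0 i : {linear 'rV[K]_m -> K^o}).
Proof.
move=> hp ij x; apply: (le_trans _ (pair_norm_le_lp_norm x hp ij)).
set a := sabs (x 0 i); set b := sabs (x 0 j).
have [a0 b0] : 0 <= a /\ 0 <= b by split; exact: sabs_ge0.
have [al [be [[al0 be0 albe] ha _]]] := pair_norm_profile hp a0 b0.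
apply: (le_trans ha); rewrite -[leRHS]mulr1 ler_wpM2l ?pair_norm_ge0 //.
have [_ /andP[r0 r1]] := rexpP hp.
by rewrite -(powRr0 al) powR_unit_anti ?lexx ?r0 // al0; lra.
Qed.

(** The restriction of f to two coordinates, with phases chosen to make its values
    there nonnegative, satisfies the hypothesis of [dual_pair_profile]. *)
Lemma dual_ball_profile p m (f : {linear 'rV[K]_m -> K^o}) (i j : 'I_m) :
  (1 <= p)%E -> i != j -> dual_ball (lp p) f ->
  exists al be, [/\ subprob al be,
    sabs (f 'e_i : K) <= al `^ (1 - rexp p) &
    sabs (f 'e_j : K) <= be `^ (1 - rexp p)].
Proof.
move=> hp ij hf; apply: dual_pair_profile; rewrite ?sabs_ge0 // => s t s0 t0.
have [c c1 cE] := phase_ex (f 'e_i : K); have [d d1 dE] := phase_ex (f 'e_j : K).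
have := hf ((of_real k s * c) *: 'e_i + (of_real k t * d) *: 'e_j).
rewrite lp_norm_pair // !sabsM !sabs_of_real // c1 d1 !mulr1.
rewrite linearD !linearZ /= -[X in sabs (X + _)]mulrA -[X in sabs (_ + X)]mulrA.
rewrite [c * _]cE [d * _]dE -!of_realM -of_realD sabs_of_real //.
by rewrite addr_ge0 // mulr_ge0 ?sabs_ge0.
Qed.

(** In operator language: a diagonal of modulus 1 maps l_p'^2 to l_q^2 with norm at
    most 1 when p' <= q. The dual exponents satisfy (1 - 1/p) + (1 - 1/q) >= 1. *)
Lemma injective_norm_diag_le p q m n (i i' : 'I_m) (j j' : 'I_n) (c : K) :
  (1 <= p)%E -> (1 <= q)%E -> (p^-1 + q^-1 <= 1)%E -> i != i' -> j != j' ->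
  sabs c = 1 ->
  injective_norm (lp p) (lp q) (tens 'e_i 'e_j + c *: tens 'e_i' 'e_j')
    <= 1.
Proof.
move=> hp hq pq ii jj c1.
have [pE /andP[r0 r1]] := rexpP hp; have [qE /andP[s0 s1]] := rexpP hq.
rewrite pE qE -EFinD lee_fin in pq.
apply: injective_norm_le => // f g hf hg.
rewrite mulmxDl -scalemxAl !linearD !linearZ /= !form_tens.
have [x [y [xy fx fy]]] := dual_ball_profile hp ii hf.
have [z [t [zt gz gt]]] := dual_ball_profile hq jj hg.
apply: (le_trans (sabsD _ _)); rewrite [X in _ + X]sabsM c1 mul1r !sabsM.
apply: (le_trans (lerD (ler_pM _ _ fx gz) (ler_pM _ _ fy gt))); rewrite ?sabs_ge0 //.
by apply: two_point_holder_ge1 => //; lra.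
Qed.

(** By duality with the form w |-> w_ij + c w_i'j', whose norm on products of unit
    vectors is governed by the two-coordinate Hoelder constant C. *)
Lemma projective_norm_entry_pair p q m n (C : R) (i i' : 'I_m) (j j' : 'I_n) (c : K)
    (w : 'M[K]_(m, n)) :
  (1 <= p)%E -> (1 <= q)%E -> i != i' -> j != j' -> sabs c = 1 -> 0 < C ->
  (forall x y z t, subprob x y -> subprob z t ->
    x `^ rexp p * z `^ rexp q + y `^ rexp p * t `^ rexp q <= C) ->
  sabs (w i j + c * w i' j') <= C * projective_norm (lp p) (lp q) w.
Proof.
move=> hp hq ii jj c1 C0 hC.
pose phi : {linear 'M[K]_(m, n) -> K^o} := (entry i j \+ c \*: entry i' j')%R.
rewrite -[w i j + _]/(phi w : K); apply: projective_norm_ge => // x y.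
rewrite /phi /= /entry !tensE.
apply: (le_trans (sabsD _ _)); rewrite [X in _ + X]sabsM c1 mul1r !sabsM.
have := pair_holder hp hq (sabs_ge0 (x 0 i)) (sabs_ge0 (x 0 i'))
  (sabs_ge0 (y 0 j)) (sabs_ge0 (y 0 j')) hC.
move=> /le_trans; apply; rewrite ler_pM2l // ler_pM //.
- by rewrite pair_norm_ge0 ?sabs_ge0.
- by rewrite pair_norm_ge0 ?sabs_ge0.
- exact: pair_norm_le_lp_norm.
- exact: pair_norm_le_lp_norm.
Qed.

Lemma CNJ_completion_eq2 (V : lmodType K) (N : V -> R)
    (E : completeNormedModType K) (i : {linear V -> E}) (x y : V) (c : R) :
  is_completion N i -> 0 < c -> N x <= c -> N y <= c ->
  2 * c <= N (x + y) -> 2 * c <= N (x - y) -> CNJ E = 2%:E.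
Proof.
move=> [iN _] c0; rewrite -!iN linearD linearB.
exact: CNJ_eq2.
Qed.

(** * The two von Neumann-Jordan constants *)

Lemma CNJ_injective p q m n (E : completeNormedModType K)
    (iota : {linear 'M[K]_(m, n) -> E}) (i i' : 'I_m) (j j' : 'I_n) :
  (1 <= p)%E -> (1 <= q)%E -> (p^-1 + q^-1 <= 1)%E -> i != i' -> j != j' ->
  is_completion (injective_norm (lp p) (lp q)) iota -> CNJ E = 2%:E.
Proof.
move=> hp hq pq ii jj hE.
pose x : 'M[K]_(m, n) := tens 'e_i 'e_j + 1 *: tens 'e_i' 'e_j'.
pose y : 'M[K]_(m, n) := tens 'e_i 'e_j + (-1) *: tens 'e_i' 'e_j'.
have ge2 (l l' : 'I_m) (h h' : 'I_n) : l != l' -> h != h' ->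
    2 <= injective_norm (lp p) (lp q) (tens ((2 : K) *: 'e_l) 'e_h).
  move=> ll hh; have := injective_norm_tens_ge ((2 : K) *: 'e_l) 'e_h
    (fun z => lp_norm_ge0 p z) (entry_dual_ball hp ll) (entry_dual_ball hq hh).
  by rewrite /= /entry !mxE !eqxx mulr1 sabs1 sabs_nat mulr1.
apply: (CNJ_completion_eq2 (x := x) (y := y) (c := 1) hE) => //.
- by apply: injective_norm_diag_le; rewrite // sabs1.
- by apply: injective_norm_diag_le; rewrite // sabsN sabs1.
- rewrite mulr1 (_ : x + y = tens ((2 : K) *: 'e_i) 'e_j) ?(ge2 _ i' _ j') //.
  by apply/matrixP => a b; rewrite /x /y !mxE !big_ord1 !mxE; ring.
- rewrite mulr1 (_ : x - y = tens ((2 : K) *: 'e_i') 'e_j').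
    by rewrite (ge2 _ i _ j) // eq_sym.
  by apply/matrixP => a b; rewrite /x /y !mxE !big_ord1 !mxE; ring.
Qed.

Lemma CNJ_projective p q m n (E : completeNormedModType K)
    (iota : {linear 'M[K]_(m, n) -> E}) (i i' : 'I_m) (j j' : 'I_n) :
  (1 <= p)%E -> (1 <= q)%E -> i != i' -> j != j' ->
  is_completion (projective_norm (lp p) (lp q)) iota -> CNJ E = 2%:E.
Proof.
move=> hp hq ii jj hE.
have [_ /andP[r0 r1]] := rexpP hp; have [_ /andP[s0 s1]] := rexpP hq.
have le_tens (u : 'rV[K]_m) (v : 'rV[K]_n) := projective_norm_tens_le
  (fun z => lp_norm_ge0 p z) (fun z => lp_norm_ge0 q z) u v.
have jj' : j' != j by rewrite eq_sym.
have ii' : i' != i by rewrite eq_sym.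
(* the witnesses depend on which Hoelder constant, 1 or 2^(1 - 1/p - 1/q), applies *)
have [rs1|/ltW rs1] := leP 1 (rexp p + rexp q).
  have ge2 (c : K) (w : 'M[K]_(m, n)) : sabs c = 1 -> w i j + c * w i' j' = 2 ->
      2 <= projective_norm (lp p) (lp q) w.
    move=> c1 wE; rewrite -[leRHS]mul1r -(sabs_nat 2) -wE.
    apply: projective_norm_entry_pair => // a b d e ab de.
    by apply: two_point_holder_ge1 => //; lra.
  apply: (CNJ_completion_eq2 
    (x := tens 'e_i 'e_j) (y := tens 'e_i' 'e_j') (c := 1) hE) => //.
  - rewrite (le_trans (le_tens _ _)) // (lp_norm_delta _ hp ii) //.
    by rewrite (lp_norm_delta _ hq jj) mulr1.
  - rewrite (le_trans (le_tens _ _)) // (lp_norm_delta _ hp ii') //.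
    by rewrite (lp_norm_delta _ hq jj') mulr1.
  - rewrite mulr1 (ge2 1) ?sabs1 //.
    rewrite !mxE !big_ord1 !mxE !eqxx ?(negbTE ii) ?(negbTE ii') /=; ring.
  - rewrite mulr1 (ge2 (-1)) ?sabsN ?sabs1 //.
    rewrite !mxE !big_ord1 !mxE !eqxx ?(negbTE ii) ?(negbTE ii') /=; ring.
pose c : R := 2 `^ rexp p * 2 `^ rexp q.
pose x : 'M[K]_(m, n) := tens (1 *: 'e_i + 1 *: 'e_i') (1 *: 'e_j + 1 *: 'e_j').
pose y : 'M[K]_(m, n) :=
  tens (1 *: 'e_i + (-1) *: 'e_i') (1 *: 'e_j + (-1) *: 'e_j').
have ge2c (h h' : 'I_n) (w : 'M[K]_(m, n)) : h != h' -> w i h + 1 * w i' h' = 4 ->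
    2 * c <= projective_norm (lp p) (lp q) w.
  move=> hh wE; rewrite -(@ler_pM2l _ (2 `^ (1 - rexp p - rexp q))) ?powR_gt0 //.
  apply: (@le_trans _ _ 4).
    have two (e : R) : (e == 0) ==> (2 != 0 :> R) by rewrite pnatr_eq0 implybT.
    rewrite mulrCA /c -!powRD ?two // [X in 2 `^ X](_ : _ = 1); last by ring.
    by rewrite powRr1 //; lra.
  rewrite -(sabs_nat 4) -wE.
  apply: projective_norm_entry_pair; rewrite ?sabs1 ?powR_gt0 //.
  by move=> a b d e ab de; exact: two_point_holder_le1.
apply: (CNJ_completion_eq2 (x := x) (y := y) (c := c) hE) => //.
- by rewrite mulr_gt0 ?powR_gt0.
- by rewrite (le_trans (le_tens _ _)) // !lp_norm_pair // sabs1 !pair_norm11.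
- by rewrite (le_trans (le_tens _ _)) // !lp_norm_pair // sabsN sabs1 !pair_norm11.
- rewrite (ge2c j j') // /x /y !mxE !big_ord1 !mxE !eqxx /=.
  rewrite ?(negbTE ii) ?(negbTE ii') ?(negbTE jj) ?(negbTE jj') /=; ring.
- rewrite (ge2c j' j) // /x /y !mxE !big_ord1 !mxE !eqxx /=.
  rewrite ?(negbTE ii) ?(negbTE ii') ?(negbTE jj) ?(negbTE jj') /=; ring.
Qed.

End Forms.

Local Open Scope ereal_scope.

Theorem theorem3p8 (R : realType) (k : scalar_kind) (p q : \bar R) (m n : nat)
    (hp : 1 <= p) (hq : 1 <= q) (hm : (2 <= m)%N) (hn : (2 <= n)%N) :
  (p^-1 + q^-1 <= 1 ->
    forall (E : completeNormedModType (scalars R k))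
      (i : {linear 'M[scalars R k]_(m, n) -> E}),
      is_completion (injective_norm (@lp_norm R k p m) (@lp_norm R k q n)) i ->
      CNJ E = 2%:E) /\
  (forall (E : completeNormedModType (scalars R k))
     (i : {linear 'M[scalars R k]_(m, n) -> E}),
     is_completion (projective_norm (@lp_norm R k p m) (@lp_norm R k q n)) i ->
     CNJ E = 2%:E).
Proof.
have i01 : Ordinal (ltnW hm) != Ordinal hm by [].
have j01 : Ordinal (ltnW hn) != Ordinal hn by [].
split=> [pq|] E i hE; first exact: CNJ_injective hp hq pq i01 j01 hE.
exact: CNJ_projective hp hq i01 j01 hE.
Qed.
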